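(* Let $R$ be a commutative ring with identity such that the formal power series ring $R[[x]]$ in one variable over $R$ is a coherent ring. Then $\mathrm{fPD}(R[[x]])=\mathrm{fPD}(R)+1$.
   Context: Small finitistic dimension: for a commutative ring $S$, an $S$-module $M$ has a finite projective resolution if there are an integer $n$ and an exact sequence $0\to P_n\to P_{n-1}\to\cdots\to P_1\to P_0\to M\to 0$ with every $P_i$ a finitely generated projective $S$-module. $\mathrm{fPD}(S)$ is the supremum of the projective dimensions of all $S$-modules having a finite projective resolution (possibly $\infty$; $\infty+1=\infty$). *)

(* Defs.v *)
From HB Require Import structures.
From mathcomp Require Import all_boot all_order all_algebra.
From mathcomp Require Import boolp classical_sets reals ereal Rstruct.
Set Implicit Arguments.
Unset Strict Implicit.
Unset Printing Implicit Defensive.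
Import Order.TTheory GRing.Theory Num.Theory.
Local Open Scope classical_set_scope.
Local Open Scope ring_scope.

Record fps (R : Type) := Fps { fps_coef : nat -> R }.

(* Equality of power series is not decidable: these two instances are
   classical. *)
HB.instance Definition _ (R : Type) := gen_eqMixin (fps R).
HB.instance Definition _ (R : Type) := gen_choiceMixin (fps R).

Lemma fpsP (R : Type) (f g : fps R) :
  (forall n, fps_coef f n = fps_coef g n) -> f = g.
Proof. by case: f g => f [g] /= /funext ->. Qed.

Section FpsRing.
Variable R : comNzRingType.
Implicit Types f g h : fps R.

Definition fps_zero : fps R := Fps (fun _ => 0).
Definition fps_one : fps R := Fps (fun n => (n == 0%N)%:R).
Definition fps_opp f : fps R := Fps (fun n => - fps_coef f n).
Definition fps_add f g : fps R := Fps (fun n => fps_coef f n + fps_coef g n).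
Definition fps_mul f g : fps R :=
  Fps (fun n => \sum_(i < n.+1) fps_coef f i * fps_coef g (n - i)%N).

Lemma fps_addA : associative fps_add.
Proof. by move=> f g h; apply: fpsP => n /=; rewrite addrA. Qed.

Lemma fps_addC : commutative fps_add.
Proof. by move=> f g; apply: fpsP => n /=; rewrite addrC. Qed.

Lemma fps_add0 : left_id fps_zero fps_add.
Proof. by move=> f; apply: fpsP => n /=; rewrite add0r. Qed.

Lemma fps_addN : left_inverse fps_zero fps_opp fps_add.
Proof. by move=> f; apply: fpsP => n /=; rewrite addNr. Qed.

HB.instance Definition _ :=
  GRing.isZmodule.Build (fps R) fps_addA fps_addC fps_add0 fps_addN.

Definition fps_trunc m f : {poly R} := \poly_(i < m) fps_coef f i.

Lemma fps_coef_mul_trunc m n f g : (n < m)%N ->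
  fps_coef (fps_mul f g) n = (fps_trunc m f * fps_trunc m g)`_n.
Proof.
move=> ltnm; rewrite coefM; apply: eq_bigr => i _; rewrite !coef_poly.
by rewrite (leq_trans (ltn_ord i) ltnm) (leq_ltn_trans (leq_subr _ _) ltnm).
Qed.

Lemma fps_mulC : commutative fps_mul.
Proof.
by move=> f g; apply: fpsP => n; rewrite !(fps_coef_mul_trunc _ _ (leqnn _)) mulrC.
Qed.

Lemma fps_mulA : associative fps_mul.
Proof.
have aux f g h n : fps_coef (fps_mul f (fps_mul g h)) n =
    (fps_trunc n.+1 f * (fps_trunc n.+1 g * fps_trunc n.+1 h))`_n.
  rewrite /= coefM; apply: eq_bigr => i _.
  rewrite coef_poly ltn_ord; congr (_ * _).
  by rewrite -[X in X = _]/(fps_coef (fps_mul g h) (n - i)%N)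
    (@fps_coef_mul_trunc n.+1) // ltnS leq_subr.
move=> f g h; apply: fpsP => n.
by rewrite aux (fps_mulC _ h) aux mulrA mulrC.
Qed.

Lemma fps_mul1 : left_id fps_one fps_mul.
Proof.
move=> f; apply: fpsP => n /=.
by rewrite big_ord_recl big1 ?addr0 ?mul1r ?subn0 // => i _; rewrite mul0r.
Qed.

Lemma fps_mulDl : left_distributive fps_mul fps_add.
Proof.
move=> f g h; apply: fpsP => n /=; rewrite -big_split /=.
by apply: eq_bigr => i _; rewrite mulrDl.
Qed.

Lemma fps_oner_neq0 : fps_one != 0.
Proof.
apply/eqP => /(congr1 (fun f => fps_coef f 0)) /= /eqP.
by rewrite (negbTE (oner_neq0 R)).
Qed.

HB.instance Definition _ := GRing.Zmodule_isComNzRing.Build (fps R)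
  fps_mulA fps_mulC fps_mul1 fps_mulDl fps_oner_neq0.

End FpsRing.

Definition submod (S : comNzRingType) (V : lmodType S) (W : submodClosed V) :=
  {x : V | x \in W}.

HB.instance Definition _ (S : comNzRingType) (V : lmodType S)
  (W : submodClosed V) := SubType.on (submod W).
HB.instance Definition _ (S : comNzRingType) (V : lmodType S)
  (W : submodClosed V) := Choice.on (submod W).
HB.instance Definition _ (S : comNzRingType) (V : lmodType S)
  (W : submodClosed V) := [SubChoice_isSubLmodule of submod W by <:].

Section Modules.
Variable S : comNzRingType.

Definition surj (A B : Type) (f : A -> B) := forall y, exists x, f x = y.

Definition exact (A B C : lmodType S) (f : A -> B) (g : B -> C) :=
  forall y, g y = 0 <-> exists x, f x = y.

Definition fin_generated (M : lmodType S) :=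
  exists (n : nat) (e : 'I_n -> M),
    forall x, exists c : 'I_n -> S, x = \sum_i c i *: e i.

Definition fin_presented (M : lmodType S) :=
  exists (m n : nat) (f : {linear 'rV[S]_m -> 'rV[S]_n})
         (g : {linear 'rV[S]_n -> M}),
    exact f g /\ surj g.

(* The ideals of S are the submodules of the regular module S^o. *)
Definition coherent := forall I : submodClosed S^o,
  fin_generated (submod I) -> fin_presented (submod I).

Definition projective (P : lmodType S) :=
  forall (A B : lmodType S) (g : {linear A -> B}) (f : {linear P -> B}),
    surj g -> exists h : {linear P -> A}, forall x, g (h x) = f x.

(* A resolution 0 -> P n -> ... -> P 0 -> M -> 0 is extended by zero modules
   to a family indexed by nat; exactness at P n is then the injectivity of
   P n -> P n.-1 (of P 0 -> M if n = 0). *)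
Definition proj_resolution (M : lmodType S) (n : nat) (P : nat -> lmodType S)
    (d : forall i, {linear P i.+1 -> P i}) (e : {linear P 0%N -> M}) :=
  [/\ forall i, projective (P i),
      forall i, (n < i)%N -> forall x : P i, x = 0,
      surj e,
      exact (d 0%N) e
    & forall i, exact (d i.+1) (d i)].

Definition has_proj_resolution (M : lmodType S) (n : nat) :=
  exists (P : nat -> lmodType S) (d : forall i, {linear P i.+1 -> P i})
         (e : {linear P 0%N -> M}), proj_resolution n d e.

Definition has_finite_proj_resolution (M : lmodType S) :=
  exists (n : nat) (P : nat -> lmodType S)
         (d : forall i, {linear P i.+1 -> P i}) (e : {linear P 0%N -> M}),
    proj_resolution n d e /\ forall i, fin_generated (P i).

(* Dimensions take values in {0, 1, 2, ..., +oo}, seen inside the extended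
   reals; the infimum of the empty set is +oo.  The zero module has projective
   dimension 0. *)
Definition pd (M : lmodType S) : \bar Rdefinitions.R :=
  ereal_inf [set y | exists2 n : nat, has_proj_resolution M n & y = n%:R%:E].

Definition fPD : \bar Rdefinitions.R :=
  ereal_sup [set y | exists2 M : lmodType S,
                       has_finite_proj_resolution M & y = pd M].

End Modules.

(* Main.v *)
Require Import Defs.
From HB Require Import structures.
From mathcomp Require Import all_boot all_order all_algebra.
From mathcomp Require Import boolp classical_sets reals ereal Rstruct.
Set Implicit Arguments.
Unset Strict Implicit.
Unset Printing Implicit Defensive.
Import Order.TTheory GRing.Theory Num.Theory.
Local Open Scope ring_scope.

(* Write [S = R[[x]]].  Lower bound: a finitely generated projective
   [R]-module is [L/xL] with [L] finitely generated projective over [S], so by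
   the horseshoe lemma an [R]-module [M] with a finite resolution has one over
   [S]; moreover a presentation [0 -> K -> P -> M -> 0] over [S] gives, modulo
   [x], exact sequences [0 -> M -> K/xK -> B -> 0] and
   [0 -> B -> P/xP -> M -> 0], from which [pd_R M <= pd_S M - 1] follows when
   [pd_R M] is finite and positive.
   Upper bound: the first syzygy [K] of an [S]-module is [x]-torsion free, hence
   reduction modulo [x] preserves its resolution; and a module [L] with a finite
   resolution, without [x]-torsion and with [L/xL] projective is itself
   projective, by Nakayama, so that [pd_S K <= pd_R (K/xK)]. *)

(** * Kernels, cokernels and factorization of linear maps *)

Section LinearMaps.
Variable S : comNzRingType.
Implicit Types A B C K M P Q V X : lmodType S.

Lemma linear_ex V M (f : V -> M) :
  linear f -> exists h : {linear V -> M}, h =1 f.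
Proof.
move=> lf.
exists (HB.pack_for {linear V -> M} f
  (GRing.isLinear.Build S V M *:%R f lf)).
by [].
Qed.

Definition kernel_pred V M (f : {linear V -> M}) : {pred V} :=
  [pred x | f x == 0].

Lemma kernel_submod_closed V M (f : {linear V -> M}) :
  submod_closed (kernel_pred f).
Proof.
split; first by rewrite inE linear0.
by move=> a x y; rewrite !inE linearP => /eqP-> /eqP->; rewrite scaler0 addr0.
Qed.

HB.instance Definition _ V M (f : {linear V -> M}) :=
  GRing.isSubmodClosed.Build S V (kernel_pred f) (kernel_submod_closed f).

Lemma ker_ex V M (f : {linear V -> M}) :
  exists (K : lmodType S) (i : {linear K -> V}), injective i /\ exact i f.
Proof.
exists (submod (kernel_pred f)), (\val : {linear submod (kernel_pred f) -> V}).
split; first exact: val_inj.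
move=> y; split=> [fy0|[x <-]]; last exact/eqP/(valP x).
by exists (exist _ y (introT eqP fy0)).
Qed.

(** The quotient by the image is first formed for additive groups; scalars then act through
    representatives, since the image is stable under them. *)
Lemma coker_ex V M (f : {linear V -> M}) :
  exists (Q : lmodType S) (p : {linear M -> Q}), surj p /\ exact f p.
Proof.
pose I : {pred M} := [pred y | `[< exists x, f x = y >]].
have I_closed : submod_closed I.
  split; first by apply/asboolP; exists 0; rewrite linear0.
  move=> a u v /asboolP[x <-] /asboolP[y <-].
  by apply/asboolP; exists (a *: x + y); rewrite linearP.
pose J : zmodClosed M :=
  HB.pack I (GRing.isZmodClosed.Build M I (GRing.submod_closedB I_closed)).
have JZ a x : x \in J -> a *: x \in J.
  by move=> Jx; rewrite -[_ *: _]addr0; apply: I_closed.2 Jx (rpred0 J).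
pose Q := Quotient.quot J.
pose p : M -> Q := (\pi_Q)%qT.
have pE x y : p x = p y <-> x - y \in J.
  by rewrite (Quotient.idealrBE J); split=> [/eqP|/eqP].
pose sc a (q : Q) : Q := p (a *: repr q).
have scE a x : sc a (p x) = p (a *: x).
  by apply/pE; rewrite -scalerBr; apply: JZ; apply/pE; rewrite /p reprK.
have pD x y : p (x + y) = p x + p y by rewrite /p raddfD.
have pK (q : Q) : q = p (repr q) by rewrite /p reprK.
have scA a b v : sc a (sc b v) = sc (a * b) v.
  by rewrite [v]pK !scE scalerA.
have sc1 : left_id 1 sc by move=> v; rewrite [v]pK scE scale1r.
have scDr : right_distributive sc +%R.
  by move=> a u v; rewrite [u]pK [v]pK -pD !scE scalerDr pD.
have scDl v : {morph sc^~ v : a b / a + b}.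
  by move=> a b; rewrite [v]pK !scE scalerDl pD.
pose L : lmodType S :=
  HB.pack Q (GRing.Zmodule_isLmodule.Build S Q scA sc1 scDr scDl).
have lp : linear (p : M -> L) by move=> a x y; rewrite pD -scE.
have [h hE] := linear_ex lp.
exists L, h; split=> [q|y]; first by exists (repr (q : Q)); rewrite hE /p reprK.
rewrite hE; split=> [p0|].
  have : p y = p 0 by rewrite p0 -hE linear0.
  by move/pE; rewrite subr0 => /asboolP.
move=> [x fx]; have : p y = p 0.
  by apply/pE; rewrite subr0; apply/asboolP; exists x.
by move=> ->; rewrite -hE linear0.
Qed.

(** Choice gives a set-theoretic section [s] of [p]; [f \o s] is linear because [f] is constant on
    the fibres of [p]. *)
Lemma factor_surj A B C (p : {linear A -> B}) (f : {linear A -> C}) :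
  surj p -> (forall x, p x = 0 -> f x = 0) ->
  exists h : {linear B -> C}, forall x, h (p x) = f x.
Proof.
move=> sp kpf; have [s sE] := choice sp.
have fE x y : p x = p y -> f x = f y.
  move=> pxy; apply/subr0_eq; rewrite -linearB; apply: kpf.
  by rewrite linearB pxy subrr.
have lh : linear (f \o s).
  by move=> a x y /=; rewrite -linearP; apply: fE; rewrite linearP !sE.
by have [h hE] := linear_ex lh; exists h => x; rewrite hE /=; apply: fE.
Qed.

Lemma factor_inj A B C (i : {linear A -> B}) (f : {linear C -> B}) :
  injective i -> (forall x, exists y, i y = f x) ->
  exists h : {linear C -> A}, forall x, i (h x) = f x.
Proof.
move=> ii /choice[s sE]; have ls : linear s.
  by move=> a x y; apply: ii; rewrite linearP !sE linearP.
by have [h hE] := linear_ex ls; exists h => x; rewrite hE.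
Qed.

End LinearMaps.

(** * Short exact sequences, projective modules and resolutions of bounded length *)

Section Resolutions.
Variable S : comNzRingType.
Implicit Types A B K M P Q V X Z : lmodType S.

Definition ses A B M (f : {linear A -> B}) (g : {linear B -> M}) :=
  [/\ injective f, exact f g & surj g].

Lemma ses_comp0 A B M (f : {linear A -> B}) (g : {linear B -> M}) x :
  ses f g -> g (f x) = 0.
Proof. by case=> _ efg _; apply/efg; exists x. Qed.

Lemma injective_ker V M (f : {linear V -> M}) :
  (forall x, f x = 0 -> x = 0) -> injective f.
Proof.
move=> f0 x y fxy; apply/subr0_eq/f0.
by rewrite linearB fxy subrr.
Qed.

Lemma ker_ses V M (g : {linear V -> M}) :
  surj g -> exists K (i : {linear K -> V}), ses i g.
Proof. by move=> sg; have [K [i [ii ig]]] := ker_ex g; exists K, i. Qed.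

Lemma ses_prod A B :
  exists (f : {linear A -> (A * B)%type}) (g : {linear (A * B)%type -> B}),
    ses f g.
Proof.
have [|f fE] := @linear_ex _ A (A * B)%type (fun a => (a, 0)).
  by move=> a x y; congr (_, _) => /=; rewrite scaler0 addr0.
have [|g gE] := @linear_ex _ (A * B)%type B snd; first by [].
exists f, g; split=> [x y|[a b]|b]; first by rewrite !fE => -[].
  rewrite gE; split=> [/= ->|[x]]; first by exists a; rewrite fE.
  by rewrite fE => -[].
by exists (0, b); rewrite gE.
Qed.

Lemma pairing_ex A B M (f : {linear A -> M}) (g : {linear B -> M}) :
  exists h : {linear (A * B)%type -> M}, forall p, h p = f p.1 + g p.2.
Proof.
apply: linear_ex => a p q /=.
by rewrite !linearP scalerDr addrACA.
Qed.

Lemma projective_section X Q (g : {linear X -> Q}) :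
  surj g -> projective Q -> exists s : {linear Q -> X}, cancel s g.
Proof. by move=> sg pQ; apply: (pQ X Q g idfun). Qed.

Lemma ses_retraction A X Q (f : {linear A -> X}) (g : {linear X -> Q}) :
  ses f g -> projective Q ->
  exists (s : {linear Q -> X}) (r : {linear X -> A}),
    [/\ cancel s g, cancel f r & forall x, f (r x) = x - s (g x)].
Proof.
move=> sfg pQ; have [fi efg sg] := sfg.
have [s sK] := projective_section sg pQ.
have [|h hE] := @linear_ex _ X X (fun x => x - s (g x)).
  by move=> a x y; rewrite (linearP g) (linearP s) scalerBr addrACA -opprD.
have [r rE] : exists r : {linear X -> A}, forall x, f (r x) = h x.
  by apply: factor_inj fi _ => x; apply/efg; rewrite hE linearB sK subrr.
exists s, r; split=> // [a|x]; last by rewrite rE hE.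
by apply: fi; rewrite rE hE (ses_comp0 _ sfg) linear0 subr0.
Qed.

Lemma projective_retract A P (i : {linear A -> P}) (r : {linear P -> A}) :
  cancel i r -> projective P -> projective A.
Proof.
move=> iK pP U W g f sg; have [h hE] := pP _ _ g (f \o r) sg.
by exists (h \o i) => x /=; rewrite hE /= iK.
Qed.

Lemma projective_ker A X Q (f : {linear A -> X}) (g : {linear X -> Q}) :
  ses f g -> projective Q -> projective X -> projective A.
Proof.
by move=> sfg /(ses_retraction sfg)[_ [r [_ fK _]]]; apply: projective_retract.
Qed.

Lemma projective_ext A X Q (f : {linear A -> X}) (g : {linear X -> Q}) :
  ses f g -> projective A -> projective Q -> projective X.
Proof.
move=> sfg pA pQ U W p h sp; have [s [r [_ _ rE]]] := ses_retraction sfg pQ.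
have [hA hAE] := pA _ _ p (h \o f) sp.
have [hQ hQE] := pQ _ _ p (h \o s) sp.
have [|k kE] := @linear_ex _ X U (fun x => hA (r x) + hQ (g x)).
  by move=> a x y; rewrite !linearP scalerDr addrACA.
exists k => x; rewrite kE linearD hAE hQE /= rE -linearD /=.
by rewrite subrK.
Qed.

Lemma projective_zero Z : (forall z : Z, z = 0) -> projective Z.
Proof.
move=> Z0 U W p h _; have [|k kE] := @linear_ex _ Z U (fun=> 0).
  by move=> a x y; rewrite scaler0 addr0.
by exists k => x; rewrite (Z0 x) !linear0.
Qed.

Lemma fin_generated_quot A B (f : {linear A -> B}) :
  surj f -> fin_generated A -> fin_generated B.
Proof.
move=> sf [n [e eE]]; exists n, (f \o e) => y; have [x <-] := sf y.
have [c ->] := eE x; exists c; rewrite linear_sum.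
by apply: eq_bigr => i _; rewrite linearZ.
Qed.

Lemma fin_generated_ext A X B (f : {linear A -> X}) (g : {linear X -> B}) :
  ses f g -> fin_generated A -> fin_generated B -> fin_generated X.
Proof.
case=> fi efg sg [m [a aE]] [n [b bE]]; have [s sK] := choice sg.
exists (m + n)%N, (fun k => match split k with
  inl i => f (a i) | inr j => s (b j) end) => x.
have [d dE] := bE (g x); pose y := \sum_j d j *: s (b j).
have /efg[z zE] : g (x - y) = 0.
  rewrite linearB dE /y linear_sum -sumrB big1 // => j _.
  by rewrite linearZ sK subrr.
have [c cE] := aE z; exists (fun k => match split k with
  inl i => c i | inr j => d j end).
rewrite big_split_ord /= -[LHS](subrK y) -zE cE linear_sum /y.
congr (_ + _); apply: eq_bigr => i _.
  by rewrite linearZ -/(lshift n i) (unsplitK (inl i)).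
by rewrite (unsplitK (inr i)).
Qed.

Lemma fin_generated_zero Z : (forall z : Z, z = 0) -> fin_generated Z.
Proof.
move=> Z0; exists 0%N, (fun=> 0) => x; exists (fun=> 0).
by rewrite big_ord0.
Qed.

Definition fin_proj P := projective P /\ fin_generated P.

(** Projective modules and finitely generated projective modules both satisfy these conditions, so
    that resolutions by either class are handled at once. *)
Record resolving (C : lmodType S -> Prop) := Resolving {
  resolving_proj : forall P, C P -> projective P;
  resolving_zero : forall Z, (forall z : Z, z = 0) -> C Z;
  resolving_ext : forall A X B (f : {linear A -> X}) (g : {linear X -> B}),
    ses f g -> C A -> C B -> C X }.

Lemma resolving_projective : resolving (@projective S).
Proof. split=> // [Z|A X B f g]; first exact: projective_zero.
exact: projective_ext. Qed.

Lemma resolving_fin_proj : resolving fin_proj.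
Proof.
split=> [P []//|Z Z0|A X B f g sfg [pA fA] [pB fB]].
  by split; [apply: projective_zero|apply: fin_generated_zero].
by split; [apply: projective_ext sfg _ _|apply: fin_generated_ext sfg _ _].
Qed.

(** Resolutions by [C] unfolded one syzygy [A] at a time, a form suited to induction on the
    length. *)
Fixpoint res (C : lmodType S -> Prop) (n : nat) M : Prop :=
  if n is k.+1 then
    exists A P (f : {linear A -> P}) (g : {linear P -> M}),
      [/\ ses f g, C P & res C k A]
  else C M.

Lemma zero_module : exists Z : lmodType S, forall z : Z, z = 0.
Proof. by exists 'rV[S]_0 => z; apply/rowP => -[]. Qed.

Lemma res_sub (C D : lmodType S -> Prop) n M :
  (forall P, C P -> D P) -> res C n M -> res D n M.
Proof.
move=> CD; elim: n M => [|n IHn] M /=; first exact: CD.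
move=> [A [P [f [g [sfg CP rA]]]]]; exists A, P, f, g.
by split; [|apply: CD|apply: IHn].
Qed.

(** A resolution is lengthened by a zero module at its far end. *)
Lemma res_leq C m n M : resolving C -> (m <= n)%N -> res C m M -> res C n M.
Proof.
move=> rC /subnK <-; elim: (n - m)%N => //= k IHk {}/IHk.
elim: (k + m)%N M => [|l IHl] M /= CM; last first.
  have [A [P [f [g [sfg CP rA]]]]] := CM.
  by exists A, P, f, g; split => //; apply: IHl.
have [Z Z0] := zero_module.
have [|f fE] := @linear_ex _ Z M (fun=> 0).
  by move=> a x y; rewrite scaler0 addr0.
exists Z, M, f, idfun; split=> //; last exact: resolving_zero rC _ Z0.
split=> [x y _|y|y]; first by rewrite (Z0 x) (Z0 y).
  by split=> [/= ->|[x <-]]; [exists 0; rewrite linear0|rewrite fE].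
by exists y.
Qed.

(** [P * Q] is mapped onto [X] by [a \o gA] and a lift [q] of [gB] along [b]; the kernel [K] is an
    extension of [B1] by [A1], to which the induction applies. *)
Lemma horseshoe C n A X B (a : {linear A -> X}) (b : {linear X -> B}) :
  resolving C -> ses a b -> res C n A -> res C n B -> res C n X.
Proof.
move=> rC; elim: n A X B a b => [|n IHn] A X B a b sab /=.
  exact: resolving_ext rC _ _ _ _ _ sab.
move=> [A1 [P [fA [gA [sA CP rA1]]]]] [B1 [Q [fB [gB [sB CQ rB1]]]]].
have [ai eab sb] := sab; have [fAi eA gAs] := sA; have [fBi eB gBs] := sB.
have [q qE] := resolving_proj rC CQ gB sb.
have [h hE] := pairing_ex (a \o gA) q.
have bh p : b (h p) = gB p.2.
  by rewrite hE linearD qE (ses_comp0 _ sab) add0r.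
have hs : surj h.
  move=> x; have [y yE] := gBs (b x).
  have /eab[z zE] : b (x - q y) = 0 by rewrite linearB qE yE subrr.
  have [p pE] := gAs z; exists (p, y).
  by rewrite hE /= pE zE subrK.
have [K [i sK]] := ker_ses hs; have [ii ei _] := sK.
have [jA jAE] : exists j : {linear A1 -> K}, forall x, i (j x) = (fA x, 0).
  have [|f0 f0E] := @linear_ex _ A1 (P * Q)%type (fun x => (fA x, 0)).
    by move=> c x y; congr (_, _) => /=; rewrite ?linearP // scaler0 addr0.
  have [|j jE] := factor_inj (f := f0) ii; last by exists j => x; rewrite jE.
  by move=> x; apply/ei; rewrite f0E hE /= (ses_comp0 _ sA) !linear0 addr0.
have [jB jBE] : exists j : {linear K -> B1}, forall x, fB (j x) = (i x).2.
  have [|s sE] := @linear_ex _ K Q (fun x => (i x).2).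
    by move=> c x y; rewrite linearP.
  have [|j jE] := factor_inj (f := s) fBi; last by exists j => x; rewrite jE.
  by move=> x; apply/eB; rewrite sE -bh (ses_comp0 _ sK) linear0.
have [u [v suv]] := ses_prod P Q.
exists K, (P * Q)%type, i, h; split=> //.
  exact: resolving_ext rC _ _ _ _ _ suv CP CQ.
apply: (IHn _ _ _ jA jB) rA1 rB1; split=> [|x|y].
- by move=> x y /(congr1 i); rewrite !jAE => -[/fAi].
- split=> [x0|[z zE]]; last first.
    by apply: fBi; rewrite jBE -zE jAE linear0.
  have ix2 : (i x).2 = 0 by rewrite -jBE x0 linear0.
  have /eA[z zE] : gA (i x).1 = 0.
    apply: ai; have := ses_comp0 x sK; rewrite hE ix2 linear0 addr0 /= => ->.
    by rewrite linear0.
  exists z; apply: ii; rewrite jAE zE; move: ix2.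
  by case: (i x) => ? ? /= ->.
(* Surjectivity of [K -> B1]: [q (fB y)] comes from [A], and subtracting a preimage in [P] moves
   [(0, fB y)] into [K]. *)
have /eab[z zE] : b (q (fB y)) = 0 by rewrite qE (ses_comp0 _ sB).
have [p pE] := gAs z.
have /ei[x xE] : h (- p, fB y) = 0.
  by rewrite hE /= !linearN /= pE zE addNr.
by exists x; apply: fBi; rewrite jBE xE.
Qed.

(** [X] is the fibre product of [B] and [B'] over [M]; the kernel of its projection to one factor is
    the kernel of the map from the other factor to [M]. *)
Lemma pullback A B A' B' M (f : {linear A -> B}) (g : {linear B -> M})
    (f' : {linear A' -> B'}) (g' : {linear B' -> M}) :
  ses f g -> ses f' g' ->
  exists X (u : {linear A -> X}) (v : {linear X -> B'})
    (u' : {linear A' -> X}) (v' : {linear X -> B}), ses u v /\ ses u' v'.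
Proof.
move=> sf sf'; have [fi ef gs] := sf; have [fi' ef' gs'] := sf'.
have [h hE] := pairing_ex g (\- g').
have [X [i [ii ei]]] := ker_ex h.
have [u uE] : exists j : {linear A -> X}, forall x, i (j x) = (f x, 0).
  have [|f0 f0E] := @linear_ex _ A (B * B')%type (fun x => (f x, 0)).
    by move=> c x y; congr (_, _) => /=; rewrite ?linearP // scaler0 addr0.
  have [|j jE] := factor_inj (f := f0) ii; last by exists j => x; rewrite jE.
  by move=> x; apply/ei; rewrite f0E hE /= (ses_comp0 _ sf) linear0 oppr0 addr0.
have [u' uE'] : exists j : {linear A' -> X}, forall x, i (j x) = (0, f' x).
  have [|f0 f0E] := @linear_ex _ A' (B * B')%type (fun x => (0, f' x)).
    by move=> c x y; congr (_, _) => /=; rewrite ?linearP // scaler0 addr0.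
  have [|j jE] := factor_inj (f := f0) ii; last by exists j => x; rewrite jE.
  move=> x; apply/ei.
  by rewrite f0E hE /= (ses_comp0 _ sf') linear0 oppr0 addr0.
have [|v vE] := @linear_ex _ X B' (fun x => (i x).2).
  by move=> c x y; rewrite linearP.
have [|v' vE'] := @linear_ex _ X B (fun x => (i x).1).
  by move=> c x y; rewrite linearP.
have iE x : g (i x).1 = g' (i x).2.
  by apply/subr0_eq; rewrite -[LHS](hE (i x)); apply/ei; exists x.
exists X, u, v, u', v'; split; split=> [x y|x|y].
- by move/(congr1 i); rewrite !uE => -[/fi].
- rewrite vE; split=> [x0|[z <-]]; last by rewrite uE.
  have /ef[z zE] : g (i x).1 = 0 by rewrite iE x0 linear0.
  exists z; apply: ii; rewrite uE zE; move: x0.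
  by case: (i x) => ? ? /= ->.
- have [z zE] := gs (g' y).
  have /ei[x xE] : h (z, y) = 0 by rewrite hE /= zE subrr.
  by exists x; rewrite vE xE.
- by move/(congr1 i); rewrite !uE' => -[/fi'].
- rewrite vE'; split=> [x0|[z <-]]; last by rewrite uE'.
  have /ef'[z zE] : g' (i x).2 = 0 by rewrite -iE x0 linear0.
  exists z; apply: ii; rewrite uE' zE; move: x0.
  by case: (i x) => ? ? /= ->.
have [z zE] := gs' (g y).
have /ei[x xE] : h (y, z) = 0 by rewrite hE /= zE subrr.
by exists x; rewrite vE' xE.
Qed.

Local Notation pres := (res (@projective S)).

(** For [P] projective onto [X], the kernel [P0] of [P -> Q] is projective because [P] and [Q] are,
    and it covers [A] with the same kernel [K] as [P -> X]. *)
Lemma res_ker_proj n A X Q (f : {linear A -> X}) (g : {linear X -> Q}) :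
  ses f g -> projective Q -> pres n X -> pres n A.
Proof.
case: n => [|n] sfg pQ /=; first exact: projective_ker sfg pQ.
move=> [K [P [i [p [sip pP rK]]]]]; have [ii eip ps] := sip.
have [fi efg gs] := sfg.
have gps : surj (g \o p).
  by move=> y; have [x <-] := gs y; have [z <-] := ps x; exists z.
have [P0 [j sj]] := ker_ses gps; have [ji ej _] := sj.
have [|t tE] := factor_inj (f := p \o j) fi.
  by move=> x; apply/efg; apply: ses_comp0 x sj.
have [|l lE] := factor_inj (f := i) ji.
  by move=> x; apply/ej; rewrite /= (ses_comp0 _ sip) linear0.
exists K, P0, l, t; split=> //; last exact: projective_ker sj _ _.
split=> [x y|x|y]; first by move/(congr1 j); rewrite !lE => /ii.
  split=> [x0|[z <-]]; last first.
    by apply: fi; rewrite tE /= lE (ses_comp0 _ sip) linear0.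
  have /eip[z zE] : p (j x) = 0 by rewrite -[LHS]tE x0 linear0.
  by exists z; apply: ji; rewrite lE.
have [z zE] := ps (f y).
have /ej[x xE] : (g \o p) z = 0 by rewrite /= zE (ses_comp0 _ sfg).
by exists x; apply: fi; rewrite tE /= xE.
Qed.

(** The pullback is an extension of [P'] by [A], which bounds its length, and of [P] by [A'], which
    passes the bound to [A']. *)
Lemma schanuel n A P M A' P' (f : {linear A -> P}) (g : {linear P -> M})
    (f' : {linear A' -> P'}) (g' : {linear P' -> M}) :
  ses f g -> ses f' g' -> projective P -> projective P' ->
  pres n A -> pres n A'.
Proof.
move=> sf sf' pP pP' rA.
have [X [u [v [u' [v' [suv suv']]]]]] := pullback sf sf'.
apply: res_ker_proj suv' pP _; apply: horseshoe suv rA _.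
  exact: resolving_projective.
exact: (res_leq (m := 0) resolving_projective).
Qed.

Lemma res_syzygy n A P M (f : {linear A -> P}) (g : {linear P -> M}) :
  ses f g -> projective P -> pres n M -> pres n.-1 A.
Proof.
case: n => [|n] sfg pP /=; first by move=> pM; apply: projective_ker sfg pM pP.
by move=> [A' [P' [f' [g' [sfg' pP']]]]]; apply: schanuel sfg' sfg pP' pP.
Qed.

(** The pullback of [B] and of a projective [P] covering [M] is an extension of [B] by the syzygy of
    [M], and of [P] by [A]. *)
Lemma res_ker n A B M (f : {linear A -> B}) (g : {linear B -> M}) :
  ses f g -> pres n B -> pres n.+1 M -> pres n A.
Proof.
move=> sfg rB [C [P [h [p [shp pP rC]]]]].
have [X [u [v [u' [v' [suv suv']]]]]] := pullback sfg shp.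
by apply: res_ker_proj suv pP _; apply: horseshoe resolving_projective suv' _ _.
Qed.

Lemma resolution_res C M n (P : nat -> lmodType S)
    (d : forall i, {linear P i.+1 -> P i}) (e : {linear P 0%N -> M}) :
  resolving C -> (forall i, C (P i)) -> proj_resolution n d e -> res C n M.
Proof.
move=> rC; elim: n M P d e => [|n IHn] M P d e CP [pP P0 se exe exd] /=.
  (* As [P 1] is zero, [e] is bijective; [C] passes along it because [M] is an extension of a zero
     module by [P 0]. *)
  have [Z Z0] := zero_module.
  have [|z zE] := @linear_ex _ M Z (fun=> 0).
    by move=> a x y; rewrite scaler0 addr0.
  have sez : ses e z.
    split; last by move=> y; exists 0; rewrite zE (Z0 y).
      apply: injective_ker => x /exe[y <-].
      by rewrite (P0 1%N isT y) linear0.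
    by move=> y; split=> // _; apply: se.
  exact: resolving_ext rC _ _ _ _ _ sez (CP 0%N) (resolving_zero rC Z0).
have [K [i sie]] := ker_ses se; have [ii ie _] := sie.
have [|e' eE'] := factor_inj (f := d 0%N) ii.
  by move=> x; apply/ie/exe; exists x.
exists K, (P 0%N), i, e; split=> //.
apply: (IHn _ (fun i => P i.+1) (fun i => d i.+1) e') => //; split=> //.
- by move=> k ltnk; apply: P0.
- move=> y; have /exe[x xE] := ses_comp0 y sie.
  by exists x; apply: ii; rewrite eE'.
move=> y; rewrite -(exd 0%N y); split=> [y0|y0].
  by rewrite -eE' y0 linear0.
by apply: ii; rewrite eE' y0 linear0.
Qed.

Lemma res_resolution C M n : resolving C -> res C n M ->
  exists (P : nat -> lmodType S) (d : forall i, {linear P i.+1 -> P i})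
    (e : {linear P 0%N -> M}), proj_resolution n d e /\ forall i, C (P i).
Proof.
move=> rC; have [Z Z0] := zero_module.
have CZ := resolving_zero rC Z0.
elim: n M => [|n IHn] M /=.
  move=> CM; pose P i := if i is _.+1 then Z else M.
  have [|z zE] := @linear_ex _ Z M (fun=> 0).
    by move=> a x y; rewrite scaler0 addr0.
  pose d i : {linear P i.+1 -> P i} :=
    if i is k.+1 then (idfun : {linear Z -> Z}) else z.
  have dE i x : d i x = 0 by case: i x => [|i] x; [apply: zE|apply: Z0].
  have CP i : C (P i) by case: i.
  exists P, d, idfun; split=> //; split=> //.
  - by move=> i; apply: resolving_proj rC _ _.
  - by case.
  - by move=> y; exists y.
  - move=> y; split=> [/= ->|[x <-]]; first by exists 0; rewrite linear0.
    by rewrite dE.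
  move=> i y; rewrite dE; split=> // _; exists 0.
  by rewrite linear0 [RHS]Z0.
move=> [A [Q [f [g [sfg CQ rA]]]]]; have [fi efg gs] := sfg.
have [P [d [e [[pP P0 se exe exd] CP]]]] := IHn _ rA.
(* The resolution of the syzygy is shifted by one degree and spliced to [Q] by [f \o e]. *)
pose P' i := if i is k.+1 then P k else Q.
pose d' i : {linear P' i.+1 -> P' i} :=
  if i is k.+1 then d k else (f \o e : {linear P 0%N -> Q}).
have CP' i : C (P' i) by case: i.
exists P', d', g; split=> //; split=> //.
- by move=> i; apply: resolving_proj rC _ _.
- by case=> // i; apply: P0.
- move=> y; split=> [/efg[x <-]|[x <-]]; last exact: ses_comp0 _ sfg.
  by have [z <-] := se x; exists z.
case=> [|i]; last exact: exd.
move=> y /=; split=> [|]; first by rewrite -(linear0 f) => /fi/exe.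
by move=> yd; have /exe -> := yd; rewrite linear0.
Qed.

End Resolutions.

(** * Power series: shift, constant term and units *)

Section PowerSeries.
Variable R : comNzRingType.
Implicit Types f g h : fps R.

Definition fps_X : fps R := Fps (fun n => (n == 1%N)%:R).
(** This is [(f - f(0)) / X]. *)
Definition fps_shift f : fps R := Fps (fun n => fps_coef f n.+1).
Definition fps_const (a : R) : fps R :=
  Fps (fun n => if n is 0%N then a else 0).
Definition fps_coef0 f : R := fps_coef f 0.

Lemma fps_coefM f g n :
  fps_coef (f * g) n = \sum_(i < n.+1) fps_coef f i * fps_coef g (n - i)%N.
Proof. by []. Qed.

Lemma fps_coefD f g n : fps_coef (f + g) n = fps_coef f n + fps_coef g n.
Proof. by []. Qed.

Lemma fps_coefXM f n :
  fps_coef (fps_X * f) n = if n is k.+1 then fps_coef f k else 0.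
Proof.
rewrite fps_coefM; case: n => [|n].
  by rewrite big_ord_recl big_ord0 mul0r addr0.
rewrite big_ord_recl mul0r add0r big_ord_recl mul1r subSS subn0.
by rewrite big1 ?addr0 // => i _; rewrite mul0r.
Qed.

Lemma fps_coef_constM a f n : fps_coef (fps_const a * f) n = a * fps_coef f n.
Proof.
rewrite fps_coefM big_ord_recl subn0 big1 ?addr0 // => i _.
by rewrite mul0r.
Qed.

Lemma fps_eq_shift f : f = fps_const (fps_coef0 f) + fps_X * fps_shift f.
Proof.
by apply: fpsP => -[|n]; rewrite fps_coefD fps_coefXM ?addr0 ?add0r.
Qed.

Lemma fps_X_inj : injective ( *%R fps_X : fps R -> fps R).
Proof.
move=> f g fg; apply: fpsP => n.
by have := congr1 (fun u => fps_coef u n.+1) fg; rewrite !fps_coefXM.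
Qed.

Lemma fps_coef0_zmod : zmod_morphism fps_coef0.
Proof. by []. Qed.

Lemma fps_coef0_monoid : monoid_morphism fps_coef0.
Proof.
by split=> // f g; rewrite /fps_coef0 fps_coefM big_ord_recl big_ord0 addr0.
Qed.

HB.instance Definition _ :=
  GRing.isZmodMorphism.Build (fps R) R fps_coef0 fps_coef0_zmod.
HB.instance Definition _ :=
  GRing.isMonoidMorphism.Build (fps R) R fps_coef0 fps_coef0_monoid.

Lemma fps_const_zmod : zmod_morphism fps_const.
Proof. by move=> a b; apply: fpsP => -[|n] //=; rewrite oppr0 addr0. Qed.

Lemma fps_const_monoid : monoid_morphism fps_const.
Proof.
split=> [|a b]; first by apply: fpsP => -[|n].
by apply: fpsP => n; rewrite fps_coef_constM; case: n => //= n; rewrite mulr0.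
Qed.

HB.instance Definition _ :=
  GRing.isZmodMorphism.Build R (fps R) fps_const fps_const_zmod.
HB.instance Definition _ :=
  GRing.isMonoidMorphism.Build R (fps R) fps_const fps_const_monoid.

Lemma fps_coefM_eq f g h n :
  (forall i, (i <= n)%N -> fps_coef g i = fps_coef h i) ->
  fps_coef (f * g) n = fps_coef (f * h) n.
Proof.
move=> gh; rewrite !fps_coefM; apply: eq_bigr => i _.
by rewrite gh ?leq_subr.
Qed.

(* The inverse of [1 - X h] is the limit of the iterates of
   [g |-> 1 + X h g]: the n-th iterate is exact up to the n-th coefficient. *)
Lemma fps_inv_ex f : fps_coef0 f = 1 -> exists g, g * f = 1.
Proof.
move=> f1; pose h := - fps_shift f.
have fE : f = 1 - fps_X * h.
  by rewrite {1}[f]fps_eq_shift f1 rmorph1 mulrN opprK.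
pose G n := iter n (fun g => 1 + fps_X * (h * g)) 1.
have GS n i : (i <= n)%N -> fps_coef (G n.+1) i = fps_coef (G n) i.
  elim: n i => [|n IHn] i.
    by rewrite leqn0 => /eqP->; rewrite fps_coefD fps_coefXM addr0.
  rewrite [G n.+2]iterS [G n.+1]iterS !fps_coefD !fps_coefXM.
  case: i => // i lein.
  congr (_ + _); apply: fps_coefM_eq => j leji.
  by apply: IHn; apply: leq_trans leji lein.
pose g : fps R := Fps (fun n => fps_coef (G n) n).
have gE n i : (i <= n)%N -> fps_coef g i = fps_coef (G n) i.
  move=> /subnK<-; elim: (n - i)%N => // k IHk.
  by rewrite addSn GS ?leq_addl.
exists g; suff gX : g - fps_X * (h * g) = 1.
  by rewrite fE mulrBr mulr1 mulrCA [g * h]mulrC.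
apply/eqP; rewrite subr_eq; apply/eqP/fpsP => -[|n].
  by rewrite fps_coefD fps_coefXM addr0.
rewrite (gE n.+1) // [G _]iterS !fps_coefD !fps_coefXM; congr (_ + _).
by apply: fps_coefM_eq => i lein; rewrite (gE n).
Qed.

End PowerSeries.

(** * Restriction of scalars along a ring morphism *)

Definition restr (A B : comNzRingType) (phi : {rmorphism A -> B})
  (M : lmodType B) : Type := M.

Section Restriction.
Variables (A B : comNzRingType) (phi : {rmorphism A -> B}) (M : lmodType B).
HB.instance Definition _ := GRing.Zmodule.on (restr phi M).

Let scale a (x : restr phi M) : restr phi M := phi a *: (x : M).

Let scaleA a b v : scale a (scale b v) = scale (a * b) v.
Proof. by rewrite /scale scalerA rmorphM. Qed.

Let scale1 : left_id 1 scale.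
Proof. by move=> v; rewrite /scale rmorph1 scale1r. Qed.

Let scaleDr : right_distributive scale +%R.
Proof. by move=> a u v; rewrite /scale scalerDr. Qed.

Let scaleDl v : {morph scale^~ v : a b / a + b}.
Proof. by move=> a b; rewrite /scale rmorphD scalerDl. Qed.

HB.instance Definition _ := GRing.Zmodule_isLmodule.Build A (restr phi M)
  scaleA scale1 scaleDr scaleDl.

End Restriction.

(** * Absence of [X]-torsion in projective modules *)

Section PairModule.
Variables (R : comNzRingType) (P : lmodType (fps R)).

(* The twisted product surjects onto [P] by [(p, q) |-> p + X q], and a vector
   killed by [X] is sent to 0. *)
Definition twist : Type := (P * P)%type.
HB.instance Definition _ := GRing.Zmodule.on twist.

Let scale (s : fps R) (v : twist) : twist :=
  (fps_const (fps_coef0 s) *: v.1, fps_shift s *: v.1 + s *: v.2).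

(** A twisted Leibniz rule, which makes [scale] associative. Both sides are compared after
    multiplying by [X] and adding the constant term of [s * t]. *)
Let shiftM (s t : fps R) :
  fps_shift (s * t) = fps_shift s * fps_const (fps_coef0 t) + s * fps_shift t.
Proof.
apply: fps_X_inj; rewrite mulrDr.
apply: (addrI (fps_const (fps_coef0 s) * fps_const (fps_coef0 t))).
rewrite -[in LHS]rmorphM -[in LHS]rmorphM -fps_eq_shift.
transitivity (s * (fps_const (fps_coef0 t) + fps_X R * fps_shift t)).
  by rewrite -fps_eq_shift.
by rewrite mulrDr {1}(fps_eq_shift s) mulrDl -addrA -mulrA [s * _]mulrCA.
Qed.

Let scaleA a b v : scale a (scale b v) = scale (a * b) v.
Proof.
congr (_, _) => /=; first by rewrite scalerA -rmorphM -rmorphM.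
by rewrite shiftM scalerDr !scalerA addrA -scalerDl.
Qed.

Let shift_add : {morph @fps_shift R : s t / s + t}. Proof. by []. Qed.

Let scale1 : left_id 1 scale.
Proof.
move=> [p q]; congr (_, _) => /=; first by rewrite !rmorph1 scale1r.
have -> : fps_shift 1 = 0 :> fps R by apply: fpsP.
by rewrite scale0r add0r scale1r.
Qed.

Let scaleDr : right_distributive scale +%R.
Proof.
move=> a u v; congr (_, _) => /=; first by rewrite scalerDr.
by rewrite !scalerDr addrACA.
Qed.

Let scaleDl v : {morph scale^~ v : a b / a + b}.
Proof.
move=> a b; congr (_, _) => /=; first by rewrite !rmorphD scalerDl.
by rewrite shift_add !scalerDl addrACA.
Qed.

HB.instance Definition _ := GRing.Zmodule_isLmodule.Build (fps R) twist
  scaleA scale1 scaleDr scaleDl.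

Definition torsionfree (T : lmodType (fps R)) :=
  forall t : T, fps_X R *: t = 0 -> t = 0.

Lemma fps_coef0X : fps_coef0 (fps_X R) = 0. Proof. by []. Qed.

Lemma fps_shiftX : fps_shift (fps_X R) = 1.
Proof. by apply: fpsP. Qed.

(** Let [h] be a section of [(p, q) |-> p + X q]. The second coordinate of [X *: h t] is
    [g (h t) = t], whereas [X *: h t = h (X *: t) = 0]. *)
Lemma projective_torsionfree : projective P -> torsionfree P.
Proof.
move=> pP t Xt0; pose X := fps_X R.
have [|g gE] := @linear_ex _ twist P (fun v => v.1 + X *: v.2).
  move=> a u v /=; rewrite scalerDr addrACA; congr (_ + _).
  rewrite !scalerDr !scalerA addrA -scalerDl -fps_eq_shift.
  by rewrite [a * X]mulrC.
have gs : surj g by move=> y; exists (y, 0); rewrite gE /= scaler0 addr0.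
have [h hE] := pP _ _ g idfun gs.
have := congr1 h Xt0; rewrite linear0 linearZ => -[_ /=].
by rewrite fps_shiftX scale1r => e; rewrite -[t]/(idfun t) -hE gE.
Qed.

End PairModule.

(** * Reduction modulo [X] and Nakayama's lemma *)

Section Reduction.
Variable R : comNzRingType.
Implicit Types (T K L P : lmodType (fps R)) (A B M Q : lmodType R).
Local Notation X := (fps_X R).

Definition restr0 M : lmodType (fps R) := restr (@fps_coef0 R) M.

Lemma restr0_X M (x : restr0 M) : X *: x = 0.
Proof. by rewrite -[LHS]/(fps_coef0 X *: (x : M)) fps_coef0X scale0r. Qed.

Lemma restr0_linear M Q (f : {linear M -> Q}) :
  exists h : {linear restr0 M -> restr0 Q}, forall x : M, h x = f x.
Proof. by apply: linear_ex => a x y; rewrite -linearP. Qed.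

Lemma unrestr0_linear M Q (f : {linear restr0 M -> restr0 Q}) :
  exists h : {linear M -> Q}, forall x : M, h x = f x.
Proof.
apply: linear_ex => a x y.
exact: (linearP f (fps_const a) x y).
Qed.

(** [Q] is [T / X T] up to isomorphism; describing it by its projection allows any model of the
    quotient. *)
Definition reduction T Q (p : {linear T -> restr0 Q}) :=
  surj p /\ forall t, p t = 0 <-> exists u, t = X *: u.

Lemma reduction_X T Q (p : {linear T -> restr0 Q}) u :
  reduction p -> p (X *: u) = 0.
Proof. by move=> rp; apply/rp.2; exists u. Qed.

(** The cokernel of multiplication by [X] is taken over [R], through constant series; its projection
    is linear over [R[[x]]] because [s] and its constant term differ by a multiple of [X]. *)
Lemma reduction_ex T : exists Q (p : {linear T -> restr0 Q}), reduction p.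
Proof.
pose T0 : lmodType R := restr (@fps_const R) T.
have [|f fE] := @linear_ex _ T0 T0 (fun t : T => X *: t).
  move=> a x y; rewrite -[a *: x]/(fps_const a *: (x : T)) scalerDr.
  by rewrite scalerA mulrC -scalerA.
have [Q [p [ps ep]]] := coker_ex f.
have [|h hE] := @linear_ex _ T (restr0 Q) p.
  move=> s x y; rewrite -[LHS]/(p ((s *: (x : T)) + y : T0)) linearD.
  congr (_ + _); rewrite {1}[s]fps_eq_shift scalerDl.
  rewrite -[LHS]/(p ((fps_coef0 s *: (x : T0)) + (X * fps_shift s) *: (x : T))).
  rewrite linearP; rewrite -[RHS]addr0; congr (_ + _).
  by apply/ep; exists (fps_shift s *: (x : T)); rewrite fE scalerA.
exists Q, h; split=> [y|t]; first by have [x <-] := ps y; exists x.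
by rewrite hE (ep t); split=> -[u uE]; exists u; [rewrite -uE fE|rewrite fE uE].
Qed.

Lemma reduction_map T Q T' Q' (p : {linear T -> restr0 Q})
    (p' : {linear T' -> restr0 Q'}) (f : {linear T -> T'}) :
  reduction p -> reduction p' ->
  exists h : {linear Q -> Q'}, forall t, h (p t) = p' (f t).
Proof.
move=> rp rp'; have [|h hE] := @factor_surj _ _ _ _ p (p' \o f) rp.1.
  by move=> x /rp.2[u ->]; rewrite /= linearZ reduction_X.
by have [k kE] := unrestr0_linear h; exists k => t; rewrite kE hE.
Qed.

(** Torsion-freeness of [T3] gives injectivity: if [f t = X u] then [X (g u) = 0], so [g u = 0], [u]
    comes from [T1] and [t] is a multiple of [X]. *)
Lemma reduction_ses T1 T2 T3 Q1 Q2 Q3 (p1 : {linear T1 -> restr0 Q1})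
    (p2 : {linear T2 -> restr0 Q2}) (p3 : {linear T3 -> restr0 Q3})
    (f : {linear T1 -> T2}) (g : {linear T2 -> T3}) :
  reduction p1 -> reduction p2 -> reduction p3 -> torsionfree T3 -> ses f g ->
  exists (f0 : {linear Q1 -> Q2}) (g0 : {linear Q2 -> Q3}),
    [/\ ses f0 g0, forall t, f0 (p1 t) = p2 (f t)
      & forall t, g0 (p2 t) = p3 (g t)].
Proof.
move=> r1 r2 r3 tf sfg; have [fi efg gs] := sfg.
have [f0 f0E] := reduction_map f r1 r2.
have [g0 g0E] := reduction_map g r2 r3.
exists f0, g0; split=> //; split.
- apply: injective_ker => x; have [t <-] := r1.1 x; rewrite f0E.
  move=> /r2.2[u fu]; have /efg[v vE] : g u = 0.
    by apply: tf; rewrite -linearZ -fu (ses_comp0 _ sfg).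
  apply/r1.2; exists v; apply: fi.
  by rewrite linearZ vE.
- move=> y; have [t <-] := r2.1 y; rewrite g0E; split=> [|[x]].
    move=> /r3.2[w wE]; have [v vE] := gs w.
    have /efg[s sE] : g (t - X *: v) = 0.
      by rewrite linearB linearZ vE wE subrr.
    exists (p1 s); rewrite f0E sE linearB.
    by rewrite (reduction_X _ r2) subr0.
  have [s <-] := r1.1 x; rewrite f0E => /eqP.
  rewrite eq_sym -subr_eq0 -linearB => /eqP/r2.2[u uE].
  apply/r3.2; exists (g u); rewrite -linearZ -uE linearB.
  by rewrite (ses_comp0 _ sfg) subr0.
move=> y; have [t <-] := r3.1 y; have [s <-] := gs t.
by exists (p2 s); rewrite g0E.
Qed.

(** A lifting problem over [R] is solved from [T] over [R[[x]]]; the lift factors through [p]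
    because [X] kills its target. *)
Lemma reduction_projective T Q (p : {linear T -> restr0 Q}) :
  reduction p -> projective T -> projective Q.
Proof.
move=> rp pT U W g f sg; have [g0 g0E] := restr0_linear g.
have [f0 f0E] := restr0_linear f.
have [|h hE] := pT _ _ g0 (f0 \o p).
  by move=> y; have [x <-] := sg y; exists x.
have [|k kE] := @factor_surj _ _ _ _ p h rp.1.
  by move=> x /rp.2[u ->]; rewrite linearZ_LR restr0_X.
have [l lE] := unrestr0_linear k; exists l => x.
by have [t <-] := rp.1 x; rewrite lE kE -g0E hE /= f0E.
Qed.

Lemma reduction_fin_generated T Q (p : {linear T -> restr0 Q}) :
  reduction p -> fin_generated T -> fin_generated Q.
Proof.
move=> rp [n [e eE]]; exists n, (fun i => p (e i)) => y.
have [t <-] := rp.1 y; have [c ->] := eE t.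
exists (fun i => fps_coef0 (c i)); rewrite linear_sum.
by apply: eq_bigr => i _; rewrite linearZ.
Qed.

Lemma torsionfree_inj T T' (f : {linear T -> T'}) :
  injective f -> torsionfree T' -> torsionfree T.
Proof.
move=> fi tf t Xt; apply: fi; rewrite linear0.
by apply: tf; rewrite -linearZ Xt linear0.
Qed.

(** The syzygies of [T] lie in projective modules, hence are torsion free, and each step of the
    resolution remains exact modulo [X]. *)
Lemma reduction_res (C : lmodType (fps R) -> Prop) (D : lmodType R -> Prop)
    n T Q (p : {linear T -> restr0 Q}) :
  (forall P, C P -> projective P) ->
  (forall P M (q : {linear P -> restr0 M}), reduction q -> C P -> D M) ->
  reduction p -> torsionfree T -> res C n T -> res D n Q.
Proof.
move=> Cp CD; elim: n T Q p => [|n IHn] T Q p rp tf /=; first exact: CD rp.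
move=> [A [P [f [g [sfg CP rA]]]]].
have [QA [pA rpA]] := reduction_ex A; have [QP [pP rpP]] := reduction_ex P.
have [f0 [g0 [sfg0 _ _]]] := reduction_ses rpA rpP rp tf sfg.
exists QA, QP, f0, g0; split=> //; first exact: CD rpP CP.
apply: IHn rpA _ rA; case: sfg => fi _ _; apply: torsionfree_inj fi _.
exact/projective_torsionfree/Cp.
Qed.

Lemma fin_proj_reduction T Q (p : {linear T -> restr0 Q}) :
  reduction p -> fin_proj T -> fin_proj Q.
Proof.
move=> rp [pT fT].
split; first exact: reduction_projective rp pT.
exact: reduction_fin_generated rp fT.
Qed.

(** The generators satisfy [A e = f t] with [A = 1 - X a]; [\det A] has constant term 1, so it is a
    unit and the adjugate puts each [e k] in the image of [f]. *)
Lemma nakayama T K (f : {linear T -> K}) :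
  fin_generated K -> (forall k, exists t u, k = f t + X *: u) -> surj f.
Proof.
move=> [n [e eE]] fX; have /choice[t /choice[u tu]] := fun i => fX (e i).
have /choice[a aE] := fun i => eE (u i).
pose A : 'M[fps R]_n := 1%:M - X *: \matrix_(i, j) a i j.
have AE i : \sum_j A i j *: e j = f (t i).
  rewrite -[RHS](addrK (X *: u i)) -tu aE scaler_sumr.
  have -> : e i = \sum_j (i == j)%:R *: e j.
    rewrite (bigD1 i) //= eqxx scale1r big1 ?addr0 // => j.
    by rewrite eq_sym => /negPf->; rewrite scale0r.
  rewrite -sumrB; apply: eq_bigr => j _.
  by rewrite !mxE scalerBl scalerA.
have [g gdet] : exists g, g * \det A = 1.
  apply: fps_inv_ex; rewrite -det_map_mx -[RHS](det1 R n); congr (\det _).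
  apply/matrixP => i j; rewrite !mxE rmorphB rmorph_nat rmorphM.
  by rewrite [Y in _ - Y * _](_ : _ = 0) // mul0r subr0.
have eA k : e k = f (g *: \sum_i (\adj A) k i *: t i).
  rewrite linearZ linear_sum.
  under eq_bigr => i _ do rewrite linearZ_LR -AE scaler_sumr.
  rewrite exchange_big /=.
  under eq_bigr => j _ do
    (under eq_bigr => i _ do rewrite scalerA; rewrite -scaler_suml).
  have adjE j : \sum_i (\adj A) k i * A i j = (\det A)%:M k j.
    by rewrite -mul_adj_mx mxE.
  under eq_bigr => j _ do rewrite adjE mxE.
  rewrite (bigD1 k) //= eqxx mulr1n big1 ?addr0.
    by rewrite scalerA gdet scale1r.
  by move=> j; rewrite eq_sym => /negPf->; rewrite mulr0n scale0r.
move=> y; have [c ->] := eE y.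
exists (\sum_k c k *: (g *: \sum_i (\adj A) k i *: t i)).
rewrite linear_sum; apply: eq_bigr => k _.
by rewrite linearZ -eA.
Qed.

End Reduction.

(** * Free modules of finite rank *)

Section FreeModules.
Variable S : comNzRingType.

Lemma rV_linear_ex n (M : lmodType S) (a : 'I_n -> M) :
  exists h : {linear 'rV[S]_n -> M}, forall v, h v = \sum_i v 0 i *: a i.
Proof.
apply: linear_ex => c u v; rewrite scaler_sumr -big_split.
by apply: eq_bigr => i _; rewrite !mxE scalerDl scalerA.
Qed.

Lemma projective_rV n : projective 'rV[S]_n.
Proof.
move=> A B g f sg.
have [a aE] := choice (fun i : 'I_n => sg (f (delta_mx 0 i))).
have [h hE] := rV_linear_ex a; exists h => v.
rewrite hE linear_sum [in RHS](row_sum_delta v) linear_sum.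
by apply: eq_bigr => i _; rewrite !linearZ_LR aE.
Qed.

Lemma fin_generated_rV n : fin_generated 'rV[S]_n.
Proof.
exists n, (delta_mx 0) => v; exists (v 0); exact: row_sum_delta.
Qed.

End FreeModules.

(** * Comparison of resolutions over [R] and over [R[[x]]] *)

Section ChangeOfRings.
Variable R : comNzRingType.
Implicit Types (T K L P : lmodType (fps R)) (A B M Q : lmodType R).
Local Notation X := (fps_X R).
Local Notation pres := (res (@projective _)).
Local Notation fpres := (res (@fin_proj _)).

(** [Q] is the image of an idempotent matrix [E] over [R]; the same matrix [F] over [R[[x]]] is
    idempotent, and its image [L] reduces to [Q]. *)
Lemma fin_proj_cover Q : fin_proj Q ->
  exists L (p : {linear L -> restr0 Q}), fin_proj L /\ reduction p.
Proof.
move=> [pQ [n [e eE]]]; have [q qE] := rV_linear_ex e.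
have sq : surj q.
  move=> y; have [c ->] := eE y; exists (\row_i c i).
  by rewrite qE; apply: eq_bigr => i _; rewrite mxE.
have [i iK] := projective_section sq pQ.
pose E := lin1_mx (i \o q); pose F := map_mx (@fps_const R) E.
have vE v : v *m E = i (q v) by rewrite mul_rV_lin1.
have EE : E *m E = E.
  by apply/row_matrixP => k; rewrite row_mul !rowE !vE iK.
have FF : F *m F = F by rewrite -map_mxM EE.
(* The image of the idempotent [F] is realized as the kernel of [1 - F]. *)
have [|f fE] := @linear_ex _ 'rV_n 'rV_n (fun v : 'rV[fps R]_n => v - v *m F).
  by move=> a u v; rewrite mulmxDl -scalemxAl scalerBr opprD addrACA.
have [L [j [ji ej]]] := ker_ex f.
have [|m mE] := @linear_ex _ 'rV_n 'rV_n (fun v : 'rV[fps R]_n => v *m F).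
  by move=> a u v; rewrite mulmxDl -scalemxAl.
have [|r rE] := factor_inj (f := m) ji.
  by move=> v; apply/ej; rewrite fE mE -mulmxA FF subrr.
have jF x : j x *m F = j x.
  have : f (j x) = 0 by apply/ej; exists x.
  by rewrite fE => /subr0_eq.
have jK : cancel j r by move=> x; apply: ji; rewrite rE mE jF.
have coef0F v : map_mx (@fps_coef0 R) (v *m F) = map_mx (@fps_coef0 R) v *m E.
  by rewrite map_mxM; congr (_ *m _); apply/matrixP => a b; rewrite !mxE.
have [|p pE] := @linear_ex _ L (restr0 Q)
  (fun x => q (map_mx (@fps_coef0 R) (j x))).
  by move=> a u v; rewrite linearP map_mxD map_mxZ linearP.
exists L, p; split.
  split; first exact: projective_retract jK (@projective_rV _ n).
  apply: (fin_generated_quot (f := r)) (fin_generated_rV _ n).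
  by move=> x; exists (j x).
split=> [y|x]; last rewrite pE; last split.
- have [x xE] : exists x, j x = map_mx (@fps_const R) (i y).
    by apply/ej; rewrite fE -map_mxM vE iK subrr.
  exists x; rewrite pE xE -[RHS]iK; congr (q _).
  by apply/matrixP => a b; rewrite !mxE.
- move=> q0; have j0 : map_mx (@fps_coef0 R) (j x) = 0.
    by rewrite -jF coef0F vE q0 linear0.
  pose w : 'rV[fps R]_n := map_mx (@fps_shift R) (j x).
  have Xw : j x = X *: w.
    apply/rowP => k; rewrite !mxE [LHS]fps_eq_shift.
    have /matrixP/(_ 0 k) := j0; rewrite !mxE => ->.
    by rewrite rmorph0 add0r.
  (* Since [X] can be cancelled in each coordinate, [w] is fixed by [F] as [X w] is, and so lies in
     [L]. *)
  have /ej[u uE] : f w = 0.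
    apply/rowP => k; apply: fps_X_inj; rewrite [in RHS]mxE mulr0.
    have /rowP/(_ k) : f (X *: w) = 0 by rewrite -Xw fE jF subrr.
    by rewrite linearZ_LR !mxE.
  by exists u; apply: ji; rewrite linearZ_LR uE.
move=> [u ->]; rewrite linearZ_LR map_mxZ.
by rewrite [a in q (a *: _)](_ : _ = 0) // scale0r linear0.
Qed.

(* A retraction of [K1 -> P] modulo [X] lifts to [P -> K1]; on [K1] it is the
   identity modulo [X], hence bijective by Nakayama, [K1] being projective by
   induction on the length of the resolution. *)
Lemma fin_proj_of_reduction n K Q (p : {linear K -> restr0 Q}) :
  reduction p -> torsionfree K -> projective Q -> fpres n K -> fin_proj K.
Proof.
elim: n K Q p => [|n IHn] K Q p rp tK pQ //=.
move=> [K1 [P [i [g [sig [pP fP] rK1]]]]].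
have [Q1 [p1 rp1]] := reduction_ex K1; have [P' [p2 rp2]] := reduction_ex P.
have [i0 [g0 [sig0 i0E g0E]]] := reduction_ses rp1 rp2 rp tK sig.
have [ii eig gs] := sig.
have pP' := reduction_projective rp2 pP.
have tK1 := torsionfree_inj ii (projective_torsionfree pP).
have [pK1 fK1] := IHn _ _ _ rp1 tK1 (projective_ker sig0 pQ pP') rK1.
have [_ [r [_ rK _]]] := ses_retraction sig0 pQ.
have [r' r'E] := restr0_linear r.
have [h hE] := pP _ _ p1 (r' \o p2) rp1.1.
have id_mod_surj (u : {linear K1 -> K1}) :
    (forall k, p1 (u k) = p1 k) -> surj u.
  move=> up; apply: nakayama fK1 _ => k.
  have /rp1.2[w wE] : p1 (k - u k) = 0 by rewrite linearB up subrr.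
  by exists k, w; rewrite -wE addrC subrK.
have hip k : p1 (h (i k)) = p1 k by rewrite hE /= -i0E r'E rK.
have [w wK] := projective_section (id_mod_surj (h \o i) hip) pK1.
have sw : surj w by apply: id_mod_surj => k; rewrite -hip -[in RHS](wK k).
have hK k : w (h (i k)) = k by have [l <-] := sw k; rewrite -[in RHS](wK l).
have [|f fE] := @linear_ex _ P P (fun t => t - i (w (h t))).
  move=> a x y; rewrite (linearP h) (linearP w) (linearP i).
  by rewrite opprD scalerBr addrACA.
have [|s sE] := @factor_surj _ _ _ _ g f gs.
  by move=> t /eig[k <-]; rewrite fE hK subrr.
split; last exact: fin_generated_quot gs fP.
apply: (@projective_retract _ _ _ s g) pP => y; have [t <-] := gs y.
by rewrite sE fE linearB (ses_comp0 _ sig) subr0.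
Qed.

(** Passing to a syzygy lowers the length both over [R[[x]]] and modulo [X], down to [d = 0], where
    a projective reduction forces [K] to be projective. *)
Lemma res_of_reduction d n K Q (p : {linear K -> restr0 Q}) :
  reduction p -> torsionfree K -> fpres n K -> pres d Q -> pres d K.
Proof.
elim: d n K Q p => [|d IHd] n K Q p rp tK rK rQ.
  exact: (fin_proj_of_reduction rp tK rQ rK).1.
case: n rK => [[pK _]|n /= [K1 [P [i [g [sig [pP fP] rK1]]]]]].
  exact: (res_leq (m := 0) (resolving_projective _)).
have [Q1 [p1 rp1]] := reduction_ex K1; have [P' [p2 rp2]] := reduction_ex P.
have [i0 [g0 [sig0 _ _]]] := reduction_ses rp1 rp2 rp tK sig.
exists K1, P, i, g; split=> //; apply: IHd rp1 _ rK1 _.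
  by case: sig => ii _ _; apply: torsionfree_inj ii (projective_torsionfree pP).
exact: (res_syzygy sig0 (reduction_projective rp2 pP) rQ).
Qed.

Lemma reduction_torsionfree_ses L Q (p : {linear L -> restr0 Q}) :
  reduction p -> torsionfree L ->
  exists f : {linear L -> L}, ses f p /\ forall x, f x = X *: x.
Proof.
move=> rp tL; have [|f fE] := @linear_ex _ L L (fun x => X *: x).
  by move=> a x y; rewrite scalerDr !scalerA mulrC.
exists f; split=> //; split; last exact: rp.1.
  by apply: injective_ker => x; rewrite fE; apply: tL.
by move=> y; rewrite rp.2; split=> -[x xE]; exists x; rewrite -?fE // xE fE.
Qed.

(** A projective [L / X L] is resolved by [X : L -> L]. In general, with [L] reducing to [P], the
    kernel of [L -> M] is an extension of [restr0 A] by [L], and the horseshoe lemma applies. *)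
Lemma fpres_restr0 n M : fpres n M -> fpres n.+1 (restr0 M).
Proof.
elim: n M => [|n IHn] M.
  move=> /fin_proj_cover[L [p [fL rp]]].
  have tL := projective_torsionfree fL.1.
  have [f [sfp _]] := reduction_torsionfree_ses rp tL.
  by exists L, L, f, p.
move=> [A [P [f [g [sfg /fin_proj_cover[L [p [fL rp]]] /IHn rA]]]]].
have tL := projective_torsionfree fL.1; have [fi efg gs] := sfg.
have [x [sxp xE]] := reduction_torsionfree_ses rp tL.
have [f' f'E] := restr0_linear f; have [g' g'E] := restr0_linear g.
have f'i : injective f' by move=> u v; rewrite !f'E; apply: fi.
have gps : surj (g' \o p).
  move=> y; have [u <-] := gs y; have [v <-] := rp.1 u.
  by exists v; rewrite /= g'E.
have [Z [j sj]] := ker_ses gps; have [ji ej _] := sj.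
have [|l lE] := factor_inj (f := x) ji.
  by move=> u; apply/ej; rewrite /= (ses_comp0 _ sxp) linear0.
have [|k kE] := factor_inj (f := p \o j) f'i.
  move=> u; have /= := ses_comp0 u sj.
  by rewrite g'E => /efg[v vE]; exists v; rewrite f'E vE.
exists Z, L, j, (g' \o p); split=> //.
apply: (horseshoe (a := l) (b := k) (resolving_fin_proj _)) _ rA; last first.
  exact: (res_leq (m := 0) (resolving_fin_proj _)).
have [xi exp _] := sxp.
split=> [u v|u|u]; first by move=> /(congr1 j); rewrite !lE => /xi.
  split=> [u0|[v <-]]; last first.
    by apply: f'i; rewrite kE /= lE (ses_comp0 _ sxp) linear0.
  have /exp[v vE] : p (j u) = 0 by rewrite -[LHS]kE u0 linear0.
  by exists v; apply: ji; rewrite lE.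
have [t tE] := rp.1 (f' u).
have /ej[v vE] : (g' \o p) t = 0.
  by rewrite /= tE g'E f'E (ses_comp0 _ sfg).
by exists v; apply: f'i; rewrite kE /= vE.
Qed.

(** The kernel of [P / X P -> M] is [B], and that of [K / X K -> B] is a copy of [M]. The finite
    bound [m] starts a descent to the bound [k] known for [K / X K]. *)
Lemma res_restr0 m n M : pres m M -> pres n (restr0 M) -> pres n.-1 M.
Proof.
case: n => [|k] rM /=.
  (* A projective module has no [X]-torsion while [X] kills [restr0 M], so [M] is zero. *)
  move=> /projective_torsionfree tM; apply: projective_zero => x.
  by apply: (tM x); rewrite restr0_X.
move=> [K [P [i [e [sie pP rK]]]]]; have tP := projective_torsionfree pP.
have [ii eie es] := sie.
have [Kr [pK rpK]] := reduction_ex K; have [Pr [pp rpP]] := reduction_ex P.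
have pPr := reduction_projective rpP pP.
have tK := torsionfree_inj ii tP.
have rKr : pres k Kr.
  by apply: reduction_res rpK tK rK => // U V q; apply: reduction_projective.
have [|e0 e0E] := @factor_surj _ _ _ _ pp e rpP.1.
  by move=> t /rpP.2[u ->]; rewrite linearZ_LR restr0_X.
have [e' e'E] := unrestr0_linear e0.
have se' : surj e'.
  by move=> y; have [t <-] := es y; exists (pp t); rewrite e'E e0E.
have [B [b sb]] := ker_ses se'; have [bi eb _] := sb.
have [i' i'E] := reduction_map i rpK rpP.
have [|x xE] := @linear_ex _ P P (fun x => X *: x).
  by move=> a u v; rewrite scalerDr !scalerA mulrC.
(* [X P] lies in [K] because [X] kills [M]. *)
have [|c cE] := factor_inj (f := x) ii.
  by move=> t; apply/eie; rewrite xE linearZ_LR restr0_X.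
(* The embedding of [M] sends [e t] to the class of [X t], which vanishes in [K / X K] when [t] is
   in [K]. *)
have [|d0 d0E] := @factor_surj _ _ _ _ e (pK \o c) es.
  move=> t /eie[s sE]; rewrite /= (_ : c t = X *: s) ?(reduction_X _ rpK) //.
  by apply: ii; rewrite cE xE linearZ_LR sE.
have [d dE] := unrestr0_linear d0.
have [|g gE] := factor_inj (f := i') bi.
  move=> y; have [s <-] := rpK.1 y; apply/eb.
  by rewrite i'E e'E e0E (ses_comp0 _ sie).
have sdg : ses d g.
  split.
  - apply: injective_ker => y; have [t <-] := es y; rewrite dE d0E.
    move=> /rpK.2[s sE]; apply/eie; exists s; apply/subr0_eq/tP.
    by rewrite scalerBr -linearZ_LR -sE cE xE subrr.
  - move=> y; have [s <-] := rpK.1 y; split=> [gs0|[z]].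
      have /rpP.2[t tE] : pp (i s) = 0 by rewrite -i'E -gE gs0 linear0.
      exists (e t); rewrite dE d0E /=; congr (pK _); apply: ii.
      by rewrite cE xE.
    have [t <-] := es z; rewrite dE d0E => <-; apply: bi.
    by rewrite gE i'E cE xE (reduction_X _ rpP) linear0.
  move=> y; have [t tE] := rpP.1 (b y).
  have /eie[s sE] : e t = 0 by rewrite -e0E -e'E tE (ses_comp0 _ sb).
  by exists (pK s); apply: bi; rewrite gE i'E sE.
have rp := resolving_projective R.
(* Descent from [m + 1] to [m] while [m + 1 > k]: the syzygy [B] has length at most [m], and
   [K / X K] has length at most [k <= m], so [res_ker] bounds [M] by [m]. *)
elim: m rM => [|m IHm] rM; first exact: (res_leq (m := 0) rp).
have [lemk|ltkm] := leqP m.+1 k; first exact: res_leq rp lemk rM.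
apply: IHm; apply: res_ker sdg _ _.
  exact: res_leq rp _ rKr.
exact: res_leq rp (leqnSn m) (res_syzygy sb pPr rM).
Qed.

End ChangeOfRings.

(** * Projective dimension as a least length *)

Section ProjectiveDimension.
Variable S : comNzRingType.
Implicit Types M : lmodType S.
Local Notation pres := (res (@projective S)).
Local Notation fpres := (res (@fin_proj S)).
Local Open Scope ereal_scope.

Lemma has_proj_resolutionP M n : has_proj_resolution M n <-> pres n M.
Proof.
split=> [[P [d [e rPde]]]|/(res_resolution (resolving_projective S))].
  by apply: (resolution_res (resolving_projective S) _ rPde); case: rPde.
by case=> P [d [e [rPde _]]]; exists P, d, e.
Qed.

Lemma has_finite_proj_resolutionP M :
  has_finite_proj_resolution M <-> exists n, fpres n M.
Proof.
split=> [[n [P [d [e [rPde fP]]]]]|[n]].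
  exists n; apply: (resolution_res (resolving_fin_proj S) _ rPde) => i.
  by split; [case: rPde|].
move=> /(res_resolution (resolving_fin_proj S))[P [d [e [rPde fP]]]].
by exists n, P, d, e; split=> // i; case: (fP i).
Qed.

(** Without a resolution of length [n] there is no shorter one either, so the infimum is at least
    [n + 1]. *)
Lemma pd_leP M n : pd M <= n%:R%:E <-> pres n M.
Proof.
split=> [pdn|rM]; last first.
  by apply: ereal_inf_lbound; exists n => //; apply/has_proj_resolutionP.
apply: contrapT => nrM.
have : n.+1%:R%:E <= pd M.
  apply/ereal_infP => _ [m /has_proj_resolutionP rM ->].
  rewrite lee_fin ler_nat ltnNge; apply/negP => lemn; apply: nrM.
  exact: res_leq (resolving_projective S) lemn rM.
by move=> /le_trans/(_ pdn); rewrite lee_fin ler_nat ltnn.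
Qed.

Lemma pd_nat M n : pres n M -> exists2 m, pres m M & pd M = m%:R%:E.
Proof.
move=> rM; have exM : exists k, `[< pres k M >] by exists n; apply/asboolP.
case: (ex_minnP exM) => m /asboolP rmM min_m; exists m => //.
apply/eqP; rewrite eq_le; apply/andP; split; first exact/pd_leP.
apply/ereal_infP => _ [k /has_proj_resolutionP rkM ->].
by rewrite lee_fin ler_nat; apply: min_m; apply/asboolP.
Qed.

Lemma pd_le_fPD M n : fpres n M -> pd M <= fPD S.
Proof.
move=> rM; apply: ereal_sup_ubound; exists M => //.
by apply/has_finite_proj_resolutionP; exists n.
Qed.

Lemma fpres_pres M n : fpres n M -> pres n M.
Proof. by apply: res_sub => P []. Qed.

End ProjectiveDimension.

(** * The two inequalities between the finitistic dimensions *)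

Section PowerSeriesDimension.
Variable R : comNzRingType.
Local Open Scope ereal_scope.

(** Shows that [fPD R] is at least 0, and supplies a nonzero projective module for the lower
    bound. *)
Lemma regular_fin_proj : fin_proj (R^o : lmodType R).
Proof.
have [|f fE] := @linear_ex _ 'rV[R]_1 R^o (fun v => v 0%R 0%R).
  by move=> a u v; rewrite !mxE.
have [|g gE] := @linear_ex _ R^o 'rV[R]_1 (fun a => const_mx a).
  by move=> a u v; apply/matrixP => i j; rewrite !mxE.
have gK : cancel g f by move=> a; rewrite fE gE mxE.
split; first exact: projective_retract gK (@projective_rV _ 1).
by apply: fin_generated_quot (fin_generated_rV _ 1) => a; exists (g a).
Qed.

Lemma fPD_fps_le : fPD (fps R) <= fPD R + 1.
Proof.
have fPD0 : 0 <= fPD R.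
  apply: le_trans (pd_le_fPD (n := 0) regular_fin_proj).
  by apply/ereal_infP => _ [k _ ->]; rewrite lee_fin.
apply/ereal_supP => _ [N /has_finite_proj_resolutionP[n rN] ->].
case: n rN => [[pN _]|n /= [K [P [i [g [sig [pP fP] rK]]]]]].
  apply: le_trans (_ : 0 <= _); first exact/(pd_leP N 0).
  by rewrite adde_ge0.
have [Q [p rp]] := reduction_ex K.
have tK : torsionfree K.
  by case: sig => ii _ _; apply: torsionfree_inj ii (projective_torsionfree pP).
have rQ : res (@fin_proj R) n Q.
  apply: reduction_res rp tK rK => [U []//|U V q]; exact: fin_proj_reduction.
(* The least length [d] replaces [n], since it is the one bounded by [fPD R]. *)
have [d rdQ pdQ] := pd_nat (fpres_pres rQ).
apply: (@le_trans _ _ (d%:R%:E + 1)).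
  rewrite -EFinD natr1; apply/pd_leP.
  by exists K, P, i, g; split=> //; apply: res_of_reduction rp tK rK rdQ.
by rewrite -pdQ leeD2r // (pd_le_fPD rQ).
Qed.

Lemma fPD_fps_ge : fPD R + 1 <= fPD (fps R).
Proof.
(* The 1 is moved across so that the supremum is bounded member by member, then moved back. *)
rewrite -leeBrDr //.
apply/ereal_supP => _ [M /has_finite_proj_resolutionP[n rM] ->].
rewrite leeBrDr //; have [m rmM pdM] := pd_nat (fpres_pres rM).
rewrite pdM; case: m rmM pdM => [|m] rmM pdM.
  (* A projective [M] may be zero, so [R] is used instead: it is nonzero and killed by [X], hence
     not projective over [R[[x]]]. *)
  have rR := fpres_restr0 (n := 0) regular_fin_proj.
  have [k rkR pdR] := pd_nat (fpres_pres rR).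
  apply: le_trans (pd_le_fPD rR); rewrite pdR add0e lee_fin ler1n lt0n.
  apply/eqP => k0; move: rkR; rewrite k0 => /projective_torsionfree tR.
  have /eqP := tR (1%R : R^o) (restr0_X _).
  by rewrite (negbTE (oner_neq0 R)).
have rM0 := fpres_restr0 rM; have [k rkM pdk] := pd_nat (fpres_pres rM0).
apply: le_trans (pd_le_fPD rM0); rewrite pdk -EFinD natr1 lee_fin ler_nat.
(* The truncated predecessor is harmless: [m + 1 <= k.-1] forces [k > 0], so [m + 2 <= k]. *)
have /pd_leP := res_restr0 rmM rkM; rewrite pdM lee_fin ler_nat.
by case: k {rkM pdk}.
Qed.

End PowerSeriesDimension.

Theorem theorem5p3 (R : comNzRingType) (hcoh : coherent (fps R)) :
  fPD (fps R) = (fPD R + 1)%E.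
Proof. by apply/eqP; rewrite eq_le fPD_fps_le fPD_fps_ge. Qed.
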